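(* Let $T_t=\sum_{i=0}^n\mathcal T_it^i$ be an order $n$ deformation of a $\Phi$-twisted Rota-Baxter operator $T:V\to\mathfrak g$ on a 3-Leibniz algebra $(\mathfrak g,[\cdot,\cdot,\cdot]_{\mathfrak g})$ with respect to a representation $(V;\rho^l,\rho^m,\rho^r)$. Then $T_t$ is extendable if and only if its obstruction class $[\mathrm{Ob}_T]\in\mathrm{HH}^2_T(V,\mathfrak g)$ is trivial.
   Context: All vector spaces are over an algebraically closed field $\mathbb K$ of characteristic $0$. A 3-Leibniz algebra is a vector space $\mathfrak g$ with a trilinear map $[\cdot,\cdot,\cdot]_{\mathfrak g}$ satisfying $[a,b,[x,y,z]_{\mathfrak g}]_{\mathfrak g}=[[a,b,x]_{\mathfrak g},y,z]_{\mathfrak g}+[x,[a,b,y]_{\mathfrak g},z]_{\mathfrak g}+[x,y,[a,b,z]_{\mathfrak g}]_{\mathfrak g}$. A representation of $\mathfrak g$ is a vector space $V$ with trilinear maps $\rho^l:\mathfrak g\otimes\mathfrak g\otimes V\to V$, $\rho^m:\mathfrak g\otimes V\otimes\mathfrak g\to V$, $\rho^r:V\otimes\mathfrak g\otimes\mathfrak g\to V$ such that for all $a,b,x,y,z\in\mathfrak g$, $u\in V$: $\rho^l(a,b,\rho^l(x,y,u))=\rho^l([a,b,x]_{\mathfrak g},y,u)+\rho^l(x,[a,b,y]_{\mathfrak g},u)+\rho^l(x,y,\rho^l(a,b,u))$; $\rho^l(a,b,\rho^m(x,u,z))=\rho^m([a,b,x]_{\mathfrak g},u,z)+\rho^m(x,\rho^l(a,b,u),z)+\rho^m(x,u,[a,b,z]_{\mathfrak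 g})$; $\rho^l(a,b,\rho^r(u,y,z))=\rho^r(\rho^l(a,b,u),y,z)+\rho^r(u,[a,b,y]_{\mathfrak g},z)+\rho^r(u,y,[a,b,z]_{\mathfrak g})$; $\rho^m(a,u,[x,y,z]_{\mathfrak g})=\rho^r(\rho^m(a,u,x),y,z)+\rho^m(x,\rho^m(a,u,y),z)+\rho^l(x,y,\rho^m(a,u,z))$; $\rho^r(u,b,[x,y,z]_{\mathfrak g})=\rho^r(\rho^r(u,b,x),y,z)+\rho^m(x,\rho^r(u,b,y),z)+\rho^l(x,y,\rho^r(u,b,z))$. $\Phi$ is a 2-cocycle: a trilinear map $\Phi:\mathfrak g\otimes\mathfrak g\otimes\mathfrak g\to V$ with $\Phi(a,b,[x,y,z]_{\mathfrak g})+\rho^l(a,b,\Phi(x,y,z))=\Phi([a,b,x]_{\mathfrak g},y,z)+\Phi(x,[a,b,y]_{\mathfrak g},z)+\Phi(x,y,[a,b,z]_{\mathfrak g})+\rho^l(x,y,\Phi(a,b,z))+\rho^m(x,\Phi(a,b,y),z)+\rho^r(\Phi(a,b,x),y,z)$. A linear map $T:V\to\mathfrak g$ is a $\Phi$-twisted Rota-Baxter operator if $[Tu,Tv,Tw]_{\mathfrak g}=T\big(\rho^l(Tu,Tv,w)+\rho^m(Tu,v,Tw)+\rho^r(u,Tv,Tw)+\Phi(Tu,Tv,Tw)\big)$ for all $u,v,w\in V$. Then $V$ is a 3-Leibniz algebra under $[u,v,w]_T=\rho^l(Tu,Tv,w)+\rho^m(Tu,v,Tw)+\rho^r(u,Tv,Tw)+\Phi(Tu,Tv,Tw)$,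 with representation on $\mathfrak g$ given by $\rho_T^l(u,v,x)=[Tu,Tv,x]_{\mathfrak g}-T(\rho^m(Tu,v,x)+\rho^r(u,Tv,x)+\Phi(Tu,Tv,x))$, $\rho_T^m(u,x,v)=[Tu,x,Tv]_{\mathfrak g}-T(\rho^l(Tu,x,v)+\rho^r(u,x,Tv)+\Phi(Tu,x,Tv))$, $\rho_T^r(x,u,v)=[x,Tu,Tv]_{\mathfrak g}-T(\rho^l(x,Tu,v)+\rho^m(x,u,Tv)+\Phi(x,Tu,Tv))$. Cohomology of $T$: for $n\ge1$, $\mathfrak C^n_T(V,\mathfrak g)=\mathrm{Hom}((\otimes^2V)^{\otimes(n-1)}\otimes V,\mathfrak g)$, and $\partial_T:\mathfrak C^n_T\to\mathfrak C^{n+1}_T$ is, for $U_i=u_i\otimes v_i$, $w\in V$, $$\begin{aligned}(\partial_Tf)(U_1,\dots,U_n,w)=&\sum_{1\le j<k\le n}(-1)^jf(U_1,\dots,\widehat{U_j},\dots,U_{k-1},u_k\otimes[u_j,v_j,v_k]_T+[u_j,v_j,u_k]_T\otimes v_k,U_{k+1},\dots,U_n,w)\\&+\sum_{j=1}^n(-1)^jf(U_1,\dots,\widehat{U_j},\dots,U_n,[u_j,v_j,w]_T)+\sum_{j=1}^n(-1)^{j+1}\rho^l_T(u_j,v_j,f(U_1,\dots,\widehat{U_j},\dots,U_n,w))\\&+(-1)^{n+1}\big(\rho^m_T(u_n,f(U_1,\dots,U_{n-1},v_n),w)+\rho^r_T(f(U_1,\dots,U_{n-1},u_n),v_n,w)\big).\end{aligned}$$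 $\mathrm{HH}^2_T(V,\mathfrak g)=\ker(\partial_T|_{\mathfrak C^2_T})/\partial_T(\mathfrak C^1_T)$. An order $n$ deformation of $T$ is $T_t=\sum_{i=0}^n\mathcal T_it^i$ with $\mathcal T_0=T$, $\mathcal T_i\in\mathrm{Hom}(V,\mathfrak g)$, such that, with operations extended $\mathbb K[t]/(t^{n+1})$-linearly, $[T_tu,T_tv,T_tw]_{\mathfrak g}=T_t\big(\rho^l(T_tu,T_tv,w)+\rho^m(T_tu,v,T_tw)+\rho^r(u,T_tv,T_tw)+\Phi(T_tu,T_tv,T_tw)\big)$ holds modulo $t^{n+1}$ for all $u,v,w\in V$. It is extendable if there is $\mathcal T_{n+1}\in\mathrm{Hom}(V,\mathfrak g)$ such that $T_t+\mathcal T_{n+1}t^{n+1}$ is an order $n+1$ deformation of $T$. Its obstruction class is the class of the 2-cocycle $\mathrm{Ob}_T\in\mathfrak C^2_T(V,\mathfrak g)$, $$\begin{aligned}\mathrm{Ob}_T(u,v,w)=&\sum_{i+j+k=n+1,\ 0\le i,j,k\le n}\Big([\mathcal T_iu,\mathcal T_jv,\mathcal T_kw]_{\mathfrak g}-\mathcal T_i\big(\rho^l(\mathcal T_ju,\mathcal T_kv,w)+\rho^m(\mathcal T_ju,v,\mathcal T_kw)+\rho^r(u,\mathcal T_jv,\mathcal T_kw)\big)\Big)\\&-\sum_{i+j+k+l=n+1,\ 0\le i,j,k,l\le n}\mathcal T_i\Phi(\mathcal T_ju,\mathcal T_kv,\mathcal T_lw).\end{aligned}$$ *)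

(* Defs.v *)
From HB Require Import structures.
From mathcomp Require Import all_boot all_order all_algebra.
From mathcomp Require Import boolp functions.

Set Implicit Arguments.
Unset Strict Implicit.
Unset Printing Implicit Defensive.

Import GRing.Theory.
Local Open Scope ring_scope.
Local Open Scope quotient_scope.

Section Trilinear.
Variable K : closedFieldType.

Record trilinear (A B C D : lmodType K) := Trilinear {
  tri_fun :> A -> B -> C -> D;
  tri_lin1 : forall b c, linear (fun a => tri_fun a b c);
  tri_lin2 : forall a c, linear (fun b => tri_fun a b c);
  tri_lin3 : forall a b, linear (fun c => tri_fun a b c) }.

Variables (A B C D : lmodType K) (f : trilinear A B C D).

Lemma tri1P k a a' b c : f (k *: a + a') b c = k *: f a b c + f a' b c.
Proof. exact: tri_lin1. Qed.

Lemma tri2P k a b b' c : f a (k *: b + b') c = k *: f a b c + f a b' c.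
Proof. exact: tri_lin2. Qed.

Lemma tri3P k a b c c' : f a b (k *: c + c') = k *: f a b c + f a b c'.
Proof. exact: tri_lin3. Qed.

End Trilinear.

Section Algebras.
Variable K : closedFieldType.

Record leibniz3 := Leibniz3 {
  l3_space :> lmodType K;
  br : trilinear l3_space l3_space l3_space l3_space;
  leibniz3P : forall a b x y z : l3_space,
    br a b (br x y z) = br (br a b x) y z + br x (br a b y) z + br x y (br a b z) }.

Record representation (g : leibniz3) := Representation {
  rep_space :> lmodType K;
  rhol : trilinear g g rep_space rep_space;
  rhom : trilinear g rep_space g rep_space;
  rhor : trilinear rep_space g g rep_space;
  rep_ll : forall (a b x y : g) (u : rep_space),
    rhol a b (rhol x y u)
    = rhol (br g a b x) y u + rhol x (br g a b y) u + rhol x y (rhol a b u);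
  rep_lm : forall (a b x z : g) (u : rep_space),
    rhol a b (rhom x u z)
    = rhom (br g a b x) u z + rhom x (rhol a b u) z + rhom x u (br g a b z);
  rep_lr : forall (a b y z : g) (u : rep_space),
    rhol a b (rhor u y z)
    = rhor (rhol a b u) y z + rhor u (br g a b y) z + rhor u y (br g a b z);
  rep_m : forall (a x y z : g) (u : rep_space),
    rhom a u (br g x y z)
    = rhor (rhom a u x) y z + rhom x (rhom a u y) z + rhol x y (rhom a u z);
  rep_r : forall (b x y z : g) (u : rep_space),
    rhor u b (br g x y z)
    = rhor (rhor u b x) y z + rhom x (rhor u b y) z + rhol x y (rhor u b z) }.

Record cocycle2 (g : leibniz3) (V : representation g) := Cocycle2 {
  coc_map :> trilinear g g g V;
  coc_ax : forall a b x y z : g,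
    coc_map a b (br g x y z) + rhol V a b (coc_map x y z)
    = coc_map (br g a b x) y z + coc_map x (br g a b y) z
      + coc_map x y (br g a b z) + rhol V x y (coc_map a b z)
      + rhom V x (coc_map a b y) z + rhor V (coc_map a b x) y z }.

End Algebras.

Section Operators.
Variables (K : closedFieldType) (g : leibniz3 K) (V : representation g).
Variable Phi : cocycle2 V.

Definition brT (T : V -> g) (u v w : V) : V :=
  rhol V (T u) (T v) w + rhom V (T u) v (T w) + rhor V u (T v) (T w)
  + Phi (T u) (T v) (T w).

Record twistedRB := TwistedRB {
  rb_op :> {linear V -> g};
  rb_ax : forall u v w : V,
    br g (rb_op u) (rb_op v) (rb_op w) = rb_op (brT rb_op u v w) }.

Definition rhoTl (T : V -> g) (u v : V) (x : g) : g :=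
  br g (T u) (T v) x
  - T (rhom V (T u) v x + rhor V u (T v) x + Phi (T u) (T v) x).

Definition rhoTm (T : V -> g) (u : V) (x : g) (v : V) : g :=
  br g (T u) x (T v)
  - T (rhol V (T u) x v + rhor V u x (T v) + Phi (T u) x (T v)).

Definition rhoTr (T : V -> g) (x : g) (u v : V) : g :=
  br g x (T u) (T v)
  - T (rhol V x (T u) v + rhom V x u (T v) + Phi x (T u) (T v)).

End Operators.

Section Cochains.
Variables (K : closedFieldType) (g : leibniz3 K) (V : representation g).

Definition setpair m (U : 'I_m -> V * V) (k : 'I_m) (p : V * V) : 'I_m -> V * V :=
  fun i => if i == k then p else U i.

Definition omit m (j : 'I_m.+1) (U : 'I_m.+1 -> V * V) : 'I_m -> V * V :=
  fun i => U (lift j i).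

(* Hom((V (x) V)^(x)m (x) V, g), i.e. C^(m+1)_T(V, g), is encoded as the space *)
(* of maps that are linear in each of the 2m+1 vectors; the i-th tensor factor *)
(* U_i = u_i (x) v_i is represented by the pair U i = (u_i, v_i).              *)
Record multilinear m (f : ('I_m -> V * V) -> V -> g) : Prop := Multilinear {
  ml_fst : forall U k v w, linear (fun u : V => f (setpair U k (u, v)) w);
  ml_snd : forall U k u w, linear (fun v : V => f (setpair U k (u, v)) w);
  ml_last : forall U, linear (f U) }.

End Cochains.

Section Cohomology.
Variables (K : closedFieldType) (g : leibniz3 K) (V : representation g).
Variables (Phi : cocycle2 V) (T : V -> g).

Notation bT := (brT Phi T).
Notation cofun m := (('I_m -> V * V) -> V -> g).

(* Indices are 0-based, so the sign (-1)^j of the j-th tensor factor reads     *)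
(* (-1)^(j+1) here, and (-1)^(n+1) with n = m+1 reads (-1)^m.                  *)
Definition coboundary m (f : cofun m) : cofun m.+1 := fun U w =>
  \sum_(j < m.+1) \sum_(k < m.+1 | (j < k)%N) (-1) ^+ j.+1 *:
     (f (omit j (setpair U k ((U k).1, bT (U j).1 (U j).2 (U k).2))) w
      + f (omit j (setpair U k (bT (U j).1 (U j).2 (U k).1, (U k).2))) w)
  + \sum_(j < m.+1) (-1) ^+ j.+1 *: f (omit j U) (bT (U j).1 (U j).2 w)
  + \sum_(j < m.+1) (-1) ^+ j *: rhoTl Phi T (U j).1 (U j).2 (f (omit j U) w)
  + (-1) ^+ m *:
     (rhoTm Phi T (U ord_max).1 (f (omit ord_max U) (U ord_max).2) w
      + rhoTr Phi T (f (omit ord_max U) (U ord_max).1) (U ord_max).2 w).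

Definition is_cocycle m (f : cofun m) : Prop :=
  multilinear f /\ coboundary f = 0.

Definition is_coboundary m (f : cofun m.+1) : Prop :=
  exists2 h : cofun m, multilinear h & f = coboundary h.

End Cohomology.

Arguments coboundary {K g V} Phi T {m} f U w.
Arguments is_cocycle {K g V} Phi T {m} f.
Arguments is_coboundary {K g V} Phi T {m} f.

Section HH2.
Variables (K : closedFieldType) (g : leibniz3 K) (V : representation g).
Variables (Phi : cocycle2 V) (T : twistedRB Phi).

Notation cofun m := (('I_m -> V * V) -> V -> g).

Lemma lin2D (M : lmodType K) (a : K) (x y x' y' : M) :
  a *: x + x' + (a *: y + y') = a *: (x + y) + (x' + y').
Proof. by rewrite scalerDr addrACA. Qed.

Lemma lin3D (M : lmodType K) (a : K) (x y z x' y' z' : M) :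
  a *: x + x' + (a *: y + y') + (a *: z + z')
  = a *: (x + y + z) + (x' + y' + z').
Proof. by rewrite !lin2D. Qed.

Lemma scaler_lin (M : lmodType K) (a e : K) (x y : M) :
  a *: (e *: x) + e *: y = e *: (a *: x + y).
Proof. by rewrite scalerDr !scalerA mulrC. Qed.

Lemma rhoTl_linear (S : {linear V -> g}) u v : linear (rhoTl Phi S u v).
Proof.
move=> a x y; rewrite /rhoTl !tri3P lin3D linearP.
by rewrite scalerBr opprD addrACA.
Qed.

Lemma rhoTm_linear (S : {linear V -> g}) u v : linear (fun x => rhoTm Phi S u x v).
Proof.
move=> a x y; rewrite /rhoTm !tri2P lin3D linearP.
by rewrite scalerBr opprD addrACA.
Qed.

Lemma rhoTr_linear (S : {linear V -> g}) u v : linear (fun x => rhoTr Phi S x u v).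
Proof.
move=> a x y; rewrite /rhoTr !tri1P lin3D linearP.
by rewrite scalerBr opprD addrACA.
Qed.

Lemma coboundary_linear (S : {linear V -> g}) m :
  linear (coboundary Phi S : cofun m -> cofun m.+1).
Proof.
move=> a f h; apply/funext => U; apply/funext => w.
rewrite /coboundary; set r := RHS.
have -> : r = a *: coboundary Phi S f U w + coboundary Phi S h U w by [].
rewrite /coboundary {r}; do 3!rewrite (scalerDr a).
rewrite [RHS]addrACA; congr (_ + _); last first.
  rewrite scaler_lin; congr (_ *: _).
  by rewrite (rhoTm_linear S) (rhoTr_linear S) lin2D.
rewrite [RHS]addrACA; congr (_ + _); last first.
  rewrite scaler_sumr -big_split /=; apply: eq_bigr => j _ /=.
  by rewrite scaler_lin (rhoTl_linear S).
rewrite [RHS]addrACA; congr (_ + _); last first.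
  by rewrite scaler_sumr -big_split /=; apply: eq_bigr => j _ /=; rewrite scaler_lin.
rewrite scaler_sumr -big_split /=; apply: eq_bigr => j _ /=.
rewrite scaler_sumr -big_split; apply: eq_bigr => k _ /=.
by rewrite scaler_lin; congr (_ *: _); rewrite lin2D.
Qed.

Lemma multilinearB m (f h : cofun m) :
  multilinear f -> multilinear h -> multilinear (f - h).
Proof.
have E U w : (f - h) U w = f U w - h U w by [].
case=> f1 f2 f3 [h1 h2 h3]; split.
- by move=> U k v w a x y; rewrite !E f1 h1 scalerBr opprD addrACA.
- by move=> U k v w a x y; rewrite !E f2 h2 scalerBr opprD addrACA.
- by move=> U a x y; rewrite !E f3 h3 scalerBr opprD addrACA.
Qed.

Lemma multilinear0 m : multilinear (0 : cofun m).
Proof.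
by split=> [U k v w|U k u w|U] a x y; rewrite /= scaler0 addr0.
Qed.

Lemma coboundaryB (S : {linear V -> g}) m (f h : cofun m) :
  coboundary Phi S (f - h) = coboundary Phi S f - coboundary Phi S h.
Proof.
have -> : f - h = (-1 : K) *: h + f by rewrite scaleN1r addrC.
by rewrite (coboundary_linear S) scaleN1r addrC.
Qed.

Lemma coboundary0 (S : {linear V -> g}) m : coboundary Phi S (0 : cofun m) = 0.
Proof. by rewrite -[X in coboundary _ _ X](subrr 0) coboundaryB subrr. Qed.

Definition cocycles : {pred cofun 1} := [pred f | `[< is_cocycle Phi T f >]].

Lemma cocycles_zmod_closed : zmod_closed cocycles.
Proof.
split=> [|f h /asboolP[mf cf] /asboolP[mh ch]]; apply/asboolP.
  by split; [exact: multilinear0|exact: coboundary0].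
by split; [exact: multilinearB|rewrite coboundaryB cf ch subrr].
Qed.

HB.instance Definition _ := GRing.isZmodClosed.Build _ cocycles cocycles_zmod_closed.

Definition Z2 := {f : cofun 1 | f \in cocycles}.
HB.instance Definition _ := SubChoice.on Z2.
HB.instance Definition _ := [SubChoice_isSubZmodule of Z2 by <:].

(* The elements of ker(d_T | C^2_T) lying in the image d_T(C^1_T),              *)
(* which is all of that image since d_T o d_T = 0.                             *)
Definition coboundaries : {pred Z2} := [pred f | `[< is_coboundary Phi T (val f) >]].

Lemma coboundaries_zmod_closed : zmod_closed coboundaries.
Proof.
split=> [|f h /asboolP[x mx ex] /asboolP[y my ey]]; apply/asboolP.
  by exists 0; [exact: multilinear0|rewrite coboundary0].
by exists (x - y); [exact: multilinearB|rewrite coboundaryB raddfB /= ex ey].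
Qed.

HB.instance Definition _ :=
  GRing.isZmodClosed.Build _ coboundaries coboundaries_zmod_closed.

Definition HH2 := {ideal_quot coboundaries}.
HB.instance Definition _ := GRing.Zmodule.on HH2.

Definition HH2_class (f : cofun 1) (cf : is_cocycle Phi T f) : HH2 :=
  \pi_HH2 (exist _ f (asboolT cf) : Z2).

Lemma HH2_class_eq0 f (cf : is_cocycle Phi T f) :
  HH2_class cf = 0 <-> is_coboundary Phi T f.
Proof.
rewrite /HH2_class -[0]pi_zeror; split=> [/eqP|h].
  by rewrite -Quotient.idealrBE subr0 => /asboolP.
by apply/eqP; rewrite -Quotient.idealrBE subr0; apply/asboolP.
Qed.

End HH2.

Section Truncated.
Variable K : closedFieldType.

(* An element x of M (x) K[t]/(t^(n+1)) is encoded by its coefficients x i,    *)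
(* i <= n; tri_ext and lin_ext are the K[t]/(t^(n+1))-linear extensions.        *)
Notation trunc n M := {ffun 'I_n.+1 -> M}.

Definition tconst (M : lmodType K) n (x : M) : trunc n M :=
  [ffun i : 'I_n.+1 => if i == ord0 then x else 0].

Definition tri_ext (A B C D : lmodType K) (f : trilinear A B C D) n
    (x : trunc n A) (y : trunc n B) (z : trunc n C) : trunc n D :=
  [ffun m : 'I_n.+1 => \sum_(i < n.+1) \sum_(j < n.+1)
     \sum_(k < n.+1 | (i + j + k == m)%N) f (x i) (y j) (z k)].

Definition lin_ext (A B : lmodType K) n (L : 'I_n.+1 -> {linear A -> B})
    (x : trunc n A) : trunc n B :=
  [ffun m : 'I_n.+1 => \sum_(i < n.+1) \sum_(j < n.+1 | (i + j == m)%N) L i (x j)].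

End Truncated.

Section Deformations.
Variables (K : closedFieldType) (g : leibniz3 K) (V : representation g).
Variables (Phi : cocycle2 V) (T : twistedRB Phi).

Record is_deformation n (Ts : 'I_n.+1 -> {linear V -> g}) : Prop := IsDeformation {
  def_init : Ts ord0 =1 T;
  def_eq : forall u v w : V,
    let Tt (x : V) := lin_ext Ts (tconst n x) in
    tri_ext (br g) (Tt u) (Tt v) (Tt w)
    = lin_ext Ts (tri_ext (rhol V) (Tt u) (Tt v) (tconst n w)
                  + tri_ext (rhom V) (Tt u) (tconst n v) (Tt w)
                  + tri_ext (rhor V) (tconst n u) (Tt v) (Tt w)
                  + tri_ext Phi (Tt u) (Tt v) (Tt w)) }.

Definition extend n (Ts : 'I_n.+1 -> {linear V -> g}) (S : {linear V -> g})
    (i : 'I_n.+2) : {linear V -> g} :=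
  if unlift ord_max i is Some j then Ts j else S.

Definition extendable n (Ts : 'I_n.+1 -> {linear V -> g}) : Prop :=
  exists S : {linear V -> g}, is_deformation (extend Ts S).

(* The coefficient of t^d in [T_t u, T_t v, T_t w] - T_t(brT T_t u v w) over   *)
(* K[t], where T_t = \sum_(i <= n) Ts i t^i.                                   *)
Definition defect n (Ts : 'I_n.+1 -> {linear V -> g}) (d : nat) (u v w : V) : g :=
  \sum_(i < n.+1) \sum_(j < n.+1) \sum_(k < n.+1 | (i + j + k == d)%N)
    (br g (Ts i u) (Ts j v) (Ts k w)
     - Ts i (rhol V (Ts j u) (Ts k v) w + rhom V (Ts j u) v (Ts k w)
             + rhor V u (Ts j v) (Ts k w)))
  - \sum_(i < n.+1) \sum_(j < n.+1) \sum_(k < n.+1)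
      \sum_(l < n.+1 | (i + j + k + l == d)%N)
        Ts i (Phi (Ts j u) (Ts k v) (Ts l w)).

(* The cochain Ob_T: every index in the sums of [defect] ranges over 0, .., n.  *)
Definition obstruction n (Ts : 'I_n.+1 -> {linear V -> g}) : ('I_1 -> V * V) -> V -> g :=
  fun U w => defect Ts n.+1 (U ord0).1 (U ord0).2 w.

End Deformations.

Section TrilinearTheory.
Variables (K : closedFieldType) (A B C D : lmodType K) (f : trilinear A B C D).

Lemma tri1D a a' b c : f (a + a') b c = f a b c + f a' b c.
Proof. by have := tri1P f 1 a a' b c; rewrite !scale1r. Qed.

Lemma tri2D a b b' c : f a (b + b') c = f a b c + f a b' c.
Proof. by have := tri2P f 1 a b b' c; rewrite !scale1r. Qed.

Lemma tri3D a b c c' : f a b (c + c') = f a b c + f a b c'.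
Proof. by have := tri3P f 1 a b c c'; rewrite !scale1r. Qed.

Lemma tri10 b c : f 0 b c = 0.
Proof. by apply: (addrI (f 0 b c)); rewrite -tri1D !addr0. Qed.

Lemma tri20 a c : f a 0 c = 0.
Proof. by apply: (addrI (f a 0 c)); rewrite -tri2D !addr0. Qed.

Lemma tri30 a b : f a b 0 = 0.
Proof. by apply: (addrI (f a b 0)); rewrite -tri3D !addr0. Qed.

Lemma tri1Z k a b c : f (k *: a) b c = k *: f a b c.
Proof. by have := tri1P f k a 0 b c; rewrite tri10 !addr0. Qed.

Lemma tri2Z k a b c : f a (k *: b) c = k *: f a b c.
Proof. by have := tri2P f k a b 0 c; rewrite tri20 !addr0. Qed.

Lemma tri3Z k a b c : f a b (k *: c) = k *: f a b c.
Proof. by have := tri3P f k a b c 0; rewrite tri30 !addr0. Qed.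

Lemma tri1_sum I (r : seq I) (P : pred I) (F : I -> A) b c :
  f (\sum_(i <- r | P i) F i) b c = \sum_(i <- r | P i) f (F i) b c.
Proof. exact: (big_morph (fun a => f a b c) (fun x y => tri1D x y b c) (tri10 b c)). Qed.

Lemma tri2_sum I (r : seq I) (P : pred I) (F : I -> B) a c :
  f a (\sum_(i <- r | P i) F i) c = \sum_(i <- r | P i) f a (F i) c.
Proof. exact: (big_morph (fun b => f a b c) (fun x y => tri2D a x y c) (tri20 a c)). Qed.

Lemma tri3_sum I (r : seq I) (P : pred I) (F : I -> C) a b :
  f a b (\sum_(i <- r | P i) F i) = \sum_(i <- r | P i) f a b (F i).
Proof. exact: (big_morph (f a b) (fun x y => tri3D a b x y) (tri30 a b)). Qed.

End TrilinearTheory.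

Section PolynomialFunctions.
Variable K : closedFieldType.

Definition polyfun (M : lmodType K) (h : K -> M) : Prop :=
  exists N (c : nat -> M), forall s, h s = \sum_(i < N) s ^+ i *: c i.

Lemma ext_polyfun (M : lmodType K) (h h' : K -> M) :
  h =1 h' -> polyfun h -> polyfun h'.
Proof. by move=> e [N [c E]]; exists N, c => s; rewrite -e. Qed.

Lemma polyfun_const (M : lmodType K) (x : M) : polyfun (fun=> x).
Proof. by exists 1%N, (fun=> x) => s; rewrite big_ord1 expr0 scale1r. Qed.

Lemma polyfunX (M : lmodType K) (h : K -> M) n :
  polyfun h -> polyfun (fun s => s ^+ n *: h s).
Proof.
case=> N [c E]; exists (n + N)%N, (fun i => if (i < n)%N then 0 else c (i - n)%N).
move=> s; rewrite big_split_ord /= big1 ?add0r => [|i _]; last first.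
  by rewrite ltn_ord scaler0.
rewrite E scaler_sumr; apply: eq_bigr => i _.
by rewrite scalerA exprD ltnNge leq_addr /= addKn.
Qed.

Lemma polyfunD (M : lmodType K) (h h' : K -> M) :
  polyfun h -> polyfun h' -> polyfun (fun s => h s + h' s).
Proof.
case=> N [c E] [N' [c' E']].
pose tr n (b : nat -> M) i := if (i < n)%N then b i else 0.
have trE n (b : nat -> M) m (s : K) : (n <= m)%N ->
    \sum_(i < n) s ^+ i *: b i = \sum_(i < m) s ^+ i *: tr n b i.
  move=> le; rewrite (big_ord_widen _ (fun i => s ^+ i *: b i) le) big_mkcond /=.
  by apply: eq_bigr => i _; rewrite /tr; case: ifP => _; rewrite ?scaler0.
exists (maxn N N'), (fun i => tr N c i + tr N' c' i) => s.
rewrite E E' (trE _ _ _ _ (leq_maxl N N')) (trE _ _ _ _ (leq_maxr N N')).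
by rewrite -big_split /=; apply: eq_bigr => i _; rewrite scalerDr.
Qed.

Lemma polyfun_sum (M : lmodType K) I (r : seq I) (P : pred I) (h : I -> K -> M) :
  (forall i, P i -> polyfun (h i)) -> polyfun (fun s => \sum_(i <- r | P i) h i s).
Proof.
move=> ph; elim: r => [|i r IH].
  by apply: ext_polyfun (polyfun_const 0) => s; rewrite big_nil.
case Pi: (P i); last by apply: ext_polyfun IH => s; rewrite big_cons Pi.
by apply: ext_polyfun (polyfunD (ph i Pi) IH) => s; rewrite big_cons Pi.
Qed.

Lemma polyfun_lin (M N : lmodType K) (L : {linear M -> N}) h :
  polyfun h -> polyfun (fun s => L (h s)).
Proof.
case=> D [c E]; exists D, (fun i => L (c i)) => s.
by rewrite E linear_sum; apply: eq_bigr => i _; rewrite linearZ.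
Qed.

Lemma polyfunN (M : lmodType K) (h : K -> M) :
  polyfun h -> polyfun (fun s => - h s).
Proof. exact: (polyfun_lin (-%R : {linear M -> M})). Qed.

Lemma polyfun_tri (A B C D : lmodType K) (f : trilinear A B C D) x y z :
  polyfun x -> polyfun y -> polyfun z -> polyfun (fun s => f (x s) (y s) (z s)).
Proof.
move=> [N1 [c1 E1]] [N2 [c2 E2]] [N3 [c3 E3]].
apply: (@ext_polyfun _ (fun s => \sum_(i < N1) s ^+ i *:
  (\sum_(j < N2) s ^+ j *: (\sum_(k < N3) s ^+ k *: f (c1 i) (c2 j) (c3 k))))).
  move=> s; rewrite E1 tri1_sum; apply: eq_bigr => i _; rewrite tri1Z.
  rewrite E2 tri2_sum; congr (_ *: _); apply: eq_bigr => j _; rewrite tri2Z.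
  rewrite E3 tri3_sum; congr (_ *: _); apply: eq_bigr => k _; by rewrite tri3Z.
apply: polyfun_sum => i _; apply: polyfunX.
apply: polyfun_sum => j _; apply: polyfunX.
apply: polyfun_sum => k _; apply: polyfunX; exact: polyfun_const.
Qed.

Lemma avoid_seq (L : seq K) : exists x, x \notin L.
Proof.
have : \prod_(a <- L) ('X - a%:P) != 0 by rewrite -size_poly_gt0 size_prod_XsubC.
by case/closed_nonrootP=> x; rewrite root_prod_XsubC; exists x.
Qed.

Lemma many_points N (L : seq K) :
  exists s : seq K, [/\ size s = N, uniq s & forall x, x \in s -> x \notin L].
Proof.
elim: N => [|N [s [sz us sL]]]; first by exists [::].
have [x] := avoid_seq (s ++ L); rewrite mem_cat negb_or => /andP[xs xL].
exists (x :: s); split; rewrite /= ?sz ?xs //.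
by move=> y; rewrite inE => /orP[/eqP->//|/sL].
Qed.

Lemma polyfun_eq0 (M : lmodType K) (h : K -> M) :
  polyfun h -> (forall s, s != 0 -> h s = 0) -> h 0 = 0.
Proof.
case=> N [c E] h0.
case: N E => [|N] E; first by rewrite E big_ord0.
have [s [sz us s0]] := many_points N.+1 [:: 0].
pose a : 'rV[K]_N.+1 := \row_j s`_j.
have un : Vandermonde N.+1 a \in unitmx.
  rewrite unitmxE unitfE det_Vandermonde; apply/prodf_neq0 => i _.
  apply/prodf_neq0 => j ij; rewrite !mxE subr_eq0 nth_uniq ?sz ?ltn_ord //.
  by rewrite neq_ltn ij orbT.
pose W := invmx (Vandermonde N.+1 a).
have W1 i : \sum_k Vandermonde N.+1 a i k * W k 0 = (i == 0)%:R.
  by have /matrixP/(_ i 0) := mulmxV un; rewrite !mxE.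
have : \sum_k W k 0 *: h (a 0 k) = 0.
  apply: big1 => k _; rewrite h0 ?scaler0 // mxE.
  have /s0 : s`_k \in s by rewrite mem_nth // sz.
  by rewrite inE.
have -> : \sum_k W k 0 *: h (a 0 k) = c 0%N.
  transitivity (\sum_(i < N.+1) (\sum_k Vandermonde N.+1 a i k * W k 0) *: c i).
    under eq_bigr do rewrite E scaler_sumr.
    rewrite exchange_big /=; apply: eq_bigr => i _; rewrite scaler_suml.
    by apply: eq_bigr => k _; rewrite scalerA mulrC [Vandermonde _ _ _ _]mxE.
  under eq_bigr do rewrite W1.
  by rewrite big_ord_recl big1 ?addr0 ?scale1r // => i _; rewrite scale0r.
move=> c0; rewrite E big_ord_recl big1 => [|i _].
  by rewrite addr0 expr0 scale1r.
by rewrite expr0n scale0r.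
Qed.

End PolynomialFunctions.

Ltac zmod_cancel :=
  rewrite ?addrA -[LHS]add0r -[RHS]add0r ?addrA;
  repeat match goal with
  | |- ?L + ?t = _ => rewrite ?[in RHS](addrAC _ t); apply: (congr1 (+%R^~ t))
  end.

(* Ob_T is a 2-cocycle. For every linear T the map rb_defect T satisfies the   *)
(* identity rb_defect_bianchi; apply it to T_s = \sum_i s^i Ts i for s in K,   *)
(* s <> 0, divide by s^(n+1), and evaluate the resulting polynomial at s = 0.  *)
Section ObstructionCocycle.
Variables (K : closedFieldType) (g : leibniz3 K) (V : representation g).
Variable Phi : cocycle2 V.

Section Bianchi.
Variable T : {linear V -> g}.

Notation bT := (brT Phi T).

(* The semidirect-product bracket on g (+) V twisted by Phi, second component. *)
Lemma brT_leibniz (a b x y z : V) :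
  rhol V (T a) (T b) (bT x y z) + rhom V (T a) b (br g (T x) (T y) (T z))
    + rhor V a (T b) (br g (T x) (T y) (T z))
    + Phi (T a) (T b) (br g (T x) (T y) (T z))
  = rhol V (br g (T a) (T b) (T x)) (T y) z + rhom V (br g (T a) (T b) (T x)) y (T z)
    + rhor V (bT a b x) (T y) (T z) + Phi (br g (T a) (T b) (T x)) (T y) (T z)
  + (rhol V (T x) (br g (T a) (T b) (T y)) z + rhom V (T x) (bT a b y) (T z)
    + rhor V x (br g (T a) (T b) (T y)) (T z) + Phi (T x) (br g (T a) (T b) (T y)) (T z))
  + (rhol V (T x) (T y) (bT a b z) + rhom V (T x) y (br g (T a) (T b) (T z))
    + rhor V x (T y) (br g (T a) (T b) (T z)) + Phi (T x) (T y) (br g (T a) (T b) (T z))).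
Proof.
rewrite /brT !(tri1D, tri2D, tri3D).
rewrite rep_ll (rep_lm (T a) (T b)) (rep_lr (T a) (T b)).
rewrite (rep_m (T a) (T x) (T y) (T z) b) (rep_r (T b) (T x) (T y) (T z) a).
have := coc_ax Phi (T a) (T b) (T x) (T y) (T z).
set p := Phi _ _ (br _ _ _ _); set q := rhol _ _ _ (Phi _ _ _) => E.
transitivity (p + q + (rhol V (br g (T a) (T b) (T x)) (T y) z + rhol V (T x) (br g (T a) (T b) (T y)) z +
   rhol V (T x) (T y) (rhol V (T a) (T b) z) +
   (rhom V (br g (T a) (T b) (T x)) y (T z) +
    rhom V (T x) (rhol V (T a) (T b) y) (T z) +
    rhom V (T x) y (br g (T a) (T b) (T z))) +
   (rhor V (rhol V (T a) (T b) x) (T y) (T z) +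
    rhor V x (br g (T a) (T b) (T y)) (T z) +
    rhor V x (T y) (br g (T a) (T b) (T z)))) + 
  (rhor V (rhom V (T a) b (T x)) (T y) (T z) +
   rhom V (T x) (rhom V (T a) b (T y)) (T z) +
   rhol V (T x) (T y) (rhom V (T a) b (T z))) +
  (rhor V (rhor V a (T b) (T x)) (T y) (T z) +
   rhom V (T x) (rhor V a (T b) (T y)) (T z) +
   rhol V (T x) (T y) (rhor V a (T b) (T z)))); first by zmod_cancel.
by rewrite {}E; zmod_cancel.
Qed.

Definition rb_defect (u v w : V) : g := br g (T u) (T v) (T w) - T (bT u v w).

Lemma rb_defectE u v w : br g (T u) (T v) (T w) = T (bT u v w) + rb_defect u v w.
Proof. by rewrite /rb_defect addrC subrK. Qed.

Lemma rb_defect_bianchi a b x y z :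
  rb_defect a b (bT x y z) + rhoTl Phi T a b (rb_defect x y z)
  = rb_defect (bT a b x) y z + rb_defect x (bT a b y) z + rb_defect x y (bT a b z)
    + rhoTl Phi T x y (rb_defect a b z) + rhoTm Phi T x (rb_defect a b y) z
    + rhoTr Phi T (rb_defect a b x) y z.
Proof.
have W : bT a b (bT x y z) + (rhom V (T a) b (rb_defect x y z)
      + rhor V a (T b) (rb_defect x y z) + Phi (T a) (T b) (rb_defect x y z))
  = bT (bT a b x) y z + (rhol V (rb_defect a b x) (T y) z
      + rhom V (rb_defect a b x) y (T z) + Phi (rb_defect a b x) (T y) (T z))
  + (bT x (bT a b y) z + (rhol V (T x) (rb_defect a b y) z
      + rhor V x (rb_defect a b y) (T z) + Phi (T x) (rb_defect a b y) (T z)))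
  + (bT x y (bT a b z) + (rhom V (T x) y (rb_defect a b z)
      + rhor V x (T y) (rb_defect a b z) + Phi (T x) (T y) (rb_defect a b z))).
  have := brT_leibniz a b x y z.
  rewrite [bT a b (bT x y z)]/brT [bT (bT a b x) y z]/brT.
  rewrite [bT x (bT a b y) z]/brT [bT x y (bT a b z)]/brT.
  rewrite !rb_defectE.
  move: (rb_defect x y z) (rb_defect a b x) (rb_defect a b y) (rb_defect a b z).
  move: (bT x y z) (bT a b x) (bT a b y) (bT a b z) => b1 b2 b3 b4 d1 d2 d3 d4.
  rewrite !tri1D !tri2D !tri3D => H.
  transitivity (rhol V (T a) (T b) b1 + (rhom V (T a) b (T b1) + rhom V (T a) b d1)
    + (rhor V a (T b) (T b1) + rhor V a (T b) d1)
    + (Phi (T a) (T b) (T b1) + Phi (T a) (T b) d1)); first by zmod_cancel.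
  by rewrite {}H; zmod_cancel.
have G := leibniz3P (T a) (T b) (T x) (T y) (T z).
rewrite /rhoTl /rhoTm /rhoTr.
rewrite {1}[rb_defect a b (bT x y z)]/rb_defect.
rewrite {1}[rb_defect (bT a b x) y z]/rb_defect.
rewrite {1}[rb_defect x (bT a b y) z]/rb_defect.
rewrite {1}[rb_defect x y (bT a b z)]/rb_defect.
rewrite !rb_defectE in G.
move: (congr1 T W) G => {W}.
move: (rb_defect x y z) (rb_defect a b x) (rb_defect a b y) (rb_defect a b z).
move: (bT a b (bT x y z)) (bT (bT a b x) y z) (bT x (bT a b y) z) (bT x y (bT a b z)).
move: (bT x y z) (bT a b x) (bT a b y) (bT a b z).
move=> b1 b2 b3 b4 c1 c2 c3 c4 d1 d2 d3 d4.
rewrite !tri1D !tri2D !tri3D.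
rewrite (linearD _ c1) (linearD _ _ (c4 + _)) (linearD _ (c2 + _)).
rewrite (linearD _ c2) (linearD _ c3) (linearD _ c4).
set t1 := T (_ + _ + _); set t2 := T (_ + _ + _); set t3 := T (_ + _ + _).
set t4 := T (_ + _ + _) => W G.
transitivity (br g (T a) (T b) (T b1) + br g (T a) (T b) d1 - (T c1 + t1)).
  by rewrite opprD; zmod_cancel.
by rewrite {}G {}W !opprD; zmod_cancel.
Qed.

End Bianchi.

Lemma coboundary2E (T : V -> g) (F : V -> V -> V -> g) U w :
  let a := (U ord0).1 in let b := (U ord0).2 in
  let x := (U ord_max).1 in let y := (U ord_max).2 in
  coboundary Phi T (fun (U : 'I_1 -> V * V) w => F (U ord0).1 (U ord0).2 w) U w
  = F a b (brT Phi T x y w) + rhoTl Phi T a b (F x y w)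
    - (F (brT Phi T a b x) y w + F x (brT Phi T a b y) w
       + F x y (brT Phi T a b w) + rhoTl Phi T x y (F a b w)
       + rhoTm Phi T x (F a b y) w + rhoTr Phi T (F a b x) y w).
Proof.
move=> a b x y; rewrite /coboundary !big_ord_recl !big_ord0 /=.
have l0 : lift ord0 ord0 = ord_max :> 'I_2 by apply/val_inj.
have l1 : lift ord_max ord0 = ord0 :> 'I_2 by apply/val_inj.
have o (W : 'I_2 -> V * V) : omit ord0 W ord0 = W ord_max by rewrite /omit l0.
have o' (W : 'I_2 -> V * V) : omit ord_max W ord0 = W ord0 by rewrite /omit l1.
rewrite !l0 !o !o' (big_pred1 ord_max); last by case=> [[|[|]]].
rewrite [X in _ + (X + 0)]big_pred0; last by case=> [[|[|]]].
rewrite !o /setpair eqxx /= -/a -/b -/x -/y.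
rewrite /bump /= !expr1 expr0 !addn0 !expr2 mulrNN mulr1 !scaleN1r !scale1r.
by rewrite !addr0 !opprD; zmod_cancel.
Qed.


Lemma regroup (M : lmodType K) (I : finType) (e : I -> nat) (c : I -> M) D s :
  (forall i, e i < D)%N ->
  \sum_i s ^+ e i *: c i = \sum_(d < D) s ^+ d *: (\sum_(i | e i == d) c i).
Proof.
move=> eD; under [RHS]eq_bigr do rewrite scaler_sumr big_mkcond.
rewrite exchange_big /=; apply: eq_bigr => i _.
by rewrite -big_mkcond /= (big_pred1 (Ordinal (eD i))).
Qed.

Lemma scaler_sumC (M : lmodType K) (I : finType) D s (F : 'I_D -> I -> M) :
  \sum_(d < D) s ^+ d *: (\sum_i F d i) = \sum_i \sum_(d < D) s ^+ d *: F d i.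
Proof.
by under eq_bigr do rewrite scaler_sumr; rewrite exchange_big.
Qed.

Section Family.
Variables (n : nat) (Ts : 'I_n.+1 -> {linear V -> g}).

Definition family (s : K) (u : V) : g := \sum_(i < n.+1) s ^+ i *: Ts i u.

Lemma family_linear s : linear (family s).
Proof.
move=> a u v; rewrite /family scaler_sumr -big_split; apply: eq_bigr => i _ /=.
by rewrite linearP scaler_lin.
Qed.

HB.instance Definition _ s := GRing.isLinear.Build K V g _ (family s) (family_linear s).

Lemma family0 : family 0 =1 Ts ord0.
Proof.
move=> u; rewrite /family big_ord_recl expr0 scale1r big1 ?addr0 // => i _.
by rewrite expr0n scale0r.
Qed.

Lemma polyfun_family x : polyfun x -> polyfun (fun s => family s (x s)).
Proof.
by move=> px; apply: polyfun_sum => i _; apply: polyfunX; apply: polyfun_lin.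
Qed.

Lemma family_defect s u v w D : (4 * n < D)%N ->
  rb_defect (family s) u v w = \sum_(d < D) s ^+ d *: defect Phi Ts d u v w.
Proof.
move=> ltD; have le4 (i j k l : 'I_n.+1) : (i + j + k + l < D)%N.
  apply: leq_ltn_trans ltD; rewrite !mulSn mul0n addn0 !addnA.
  by rewrite !leq_add // -ltnS.
have le3 (i j k : 'I_n.+1) : (i + j + k < D)%N.
  by apply: leq_ltn_trans (le4 i j k ord0); rewrite leq_addr.
rewrite /defect; under [RHS]eq_bigr do rewrite scalerBr.
rewrite sumrB !(@scaler_sumC _ _ D s).
under [X in _ = X - _]eq_bigr => i _.
  rewrite (@scaler_sumC _ _ D s); under eq_bigr => j _.
    rewrite -(regroup _ s (fun k => le3 i j k)).
    over.
  over.
under [X in _ = _ - X]eq_bigr => i _.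
  rewrite (@scaler_sumC _ _ D s); under eq_bigr => j _.
    rewrite (@scaler_sumC _ _ D s); under eq_bigr => k _.
      rewrite -(regroup _ s (fun l => le4 i j k l)).
      over.
    over.
  over.
rewrite /rb_defect /brT /=.
have E3 (D' : lmodType K) (f : trilinear g g g D') :
    f (family s u) (family s v) (family s w) = \sum_(i < n.+1) \sum_(j < n.+1)
      \sum_(k < n.+1) s ^+ (i + j + k) *: f (Ts i u) (Ts j v) (Ts k w).
  rewrite {1}/family tri1_sum; apply: eq_bigr => i _.
  rewrite tri1Z {1}/family tri2_sum scaler_sumr; apply: eq_bigr => j _.
  rewrite tri2Z {1}/family tri3_sum !scaler_sumr; apply: eq_bigr => k _.
  by rewrite tri3Z !scalerA -!exprD.
have El : rhol V (family s u) (family s v) w = \sum_(j < n.+1) \sum_(k < n.+1)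
    s ^+ (j + k) *: rhol V (Ts j u) (Ts k v) w.
  rewrite {1}/family tri1_sum; apply: eq_bigr => j _.
  rewrite tri1Z {1}/family tri2_sum scaler_sumr; apply: eq_bigr => k _.
  by rewrite tri2Z !scalerA -!exprD.
have Em : rhom V (family s u) v (family s w) = \sum_(j < n.+1) \sum_(k < n.+1)
    s ^+ (j + k) *: rhom V (Ts j u) v (Ts k w).
  rewrite {1}/family tri1_sum; apply: eq_bigr => j _.
  rewrite tri1Z {1}/family tri3_sum scaler_sumr; apply: eq_bigr => k _.
  by rewrite tri3Z !scalerA -!exprD.
have Er : rhor V u (family s v) (family s w) = \sum_(j < n.+1) \sum_(k < n.+1)
    s ^+ (j + k) *: rhor V u (Ts j v) (Ts k w).
  rewrite {1}/family tri2_sum; apply: eq_bigr => j _.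
  rewrite tri2Z {1}/family tri3_sum scaler_sumr; apply: eq_bigr => k _.
  by rewrite tri3Z !scalerA -!exprD.
rewrite linearD opprD addrA {}El {}Em {}Er !E3 -!big_split /=; congr (_ - _).
  rewrite {1}/family -sumrB; apply: eq_bigr => i _.
  rewrite linear_sum scaler_sumr -sumrB; apply: eq_bigr => j _.
  rewrite -!big_split /= linear_sum scaler_sumr -sumrB; apply: eq_bigr => k _.
  by rewrite -!scalerDr linearZ_LR scalerA -exprD addnA -scalerBr.
rewrite {1}/family; apply: eq_bigr => i _.
rewrite linear_sum scaler_sumr; apply: eq_bigr => j _.
rewrite linear_sum scaler_sumr; apply: eq_bigr => k _.
rewrite linear_sum scaler_sumr; apply: eq_bigr => l _.
by rewrite linearZ_LR scalerA -exprD !addnA.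
Qed.

End Family.

Section LinearClosure.
Variables M N : lmodType K.
Implicit Types f h : M -> N.

Lemma linear_fun_sum I (r : seq I) (P : pred I) (f : I -> M -> N) :
  (forall i, linear (f i)) -> linear (fun x => \sum_(i <- r | P i) f i x).
Proof.
move=> lf a x y; rewrite scaler_sumr -big_split; apply: eq_bigr => i _ /=.
exact: lf.
Qed.

Lemma linear_funD f h : linear f -> linear h -> linear (fun x => f x + h x).
Proof. by move=> lf lh a x y; rewrite lf lh scalerDr addrACA. Qed.

Lemma linear_funB f h : linear f -> linear h -> linear (fun x => f x - h x).
Proof. by move=> lf lh a x y; rewrite lf lh scalerBr opprD addrACA. Qed.

Lemma linear_funZ f a x : linear f -> f (a *: x) = a *: f x.
Proof.
move=> lf; have f0 : f 0 = 0.
  by apply: (addrI (f 0)); have := lf 1 0 0; rewrite !scale1r !addr0.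
by have := lf a x 0; rewrite f0 !addr0.
Qed.

End LinearClosure.

Lemma linear_comp (L M N : lmodType K) (S : {linear M -> N}) (f : L -> M) :
  linear f -> linear (fun x => S (f x)).
Proof. by move=> lf a x y; rewrite lf linearP. Qed.

Lemma defect_linear1 n (Ts : 'I_n.+1 -> {linear V -> g}) d v w :
  linear (fun u => defect Phi Ts d u v w).
Proof.
apply: linear_funB; do 3!apply: linear_fun_sum => ?.
  apply: linear_funB; last apply: linear_comp.
    by move=> a x y; rewrite linearP tri1P.
  apply: linear_funD; first apply: linear_funD.
  - by move=> a x y; rewrite linearP tri1P.
  - by move=> a x y; rewrite linearP tri1P.
  - by move=> a x y; rewrite tri1P.
apply: linear_fun_sum => ?; apply: linear_comp.
by move=> a x y; rewrite linearP tri1P.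
Qed.

Lemma defect_linear2 n (Ts : 'I_n.+1 -> {linear V -> g}) d u w :
  linear (fun v => defect Phi Ts d u v w).
Proof.
apply: linear_funB; do 3!apply: linear_fun_sum => ?.
  apply: linear_funB; last apply: linear_comp.
    by move=> a x y; rewrite linearP tri2P.
  apply: linear_funD; first apply: linear_funD.
  - by move=> a x y; rewrite linearP tri2P.
  - by move=> a x y; rewrite tri2P.
  - by move=> a x y; rewrite linearP tri2P.
apply: linear_fun_sum => ?; apply: linear_comp.
by move=> a x y; rewrite linearP tri2P.
Qed.

Lemma defect_linear3 n (Ts : 'I_n.+1 -> {linear V -> g}) d u v :
  linear (defect Phi Ts d u v).
Proof.
apply: linear_funB; do 3!apply: linear_fun_sum => ?.
  apply: linear_funB; last apply: linear_comp.
    by move=> a x y; rewrite linearP tri3P.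
  apply: linear_funD; first apply: linear_funD.
  - by move=> a x y; rewrite tri3P.
  - by move=> a x y; rewrite linearP tri3P.
  - by move=> a x y; rewrite linearP tri3P.
apply: linear_fun_sum => ?; apply: linear_comp.
by move=> a x y; rewrite linearP tri3P.
Qed.

Lemma polyfun_defect n (Ts : 'I_n.+1 -> {linear V -> g}) d x y z :
  polyfun x -> polyfun y -> polyfun z ->
  polyfun (fun s => defect Phi Ts d (x s) (y s) (z s)).
Proof.
move=> px py pz; apply: polyfunD; last apply: polyfunN.
  do 3!apply: polyfun_sum => ? _; apply: polyfunD; last apply: polyfunN.
    by apply: polyfun_tri; apply: polyfun_lin.
  apply: polyfun_lin; apply: polyfunD; first apply: polyfunD.
  - by apply: polyfun_tri => //; apply: polyfun_lin.
  - by apply: polyfun_tri => //; apply: polyfun_lin.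
  - by apply: polyfun_tri => //; apply: polyfun_lin.
do 4!apply: polyfun_sum => ? _; apply: polyfun_lin.
by apply: polyfun_tri; apply: polyfun_lin.
Qed.

Section Cocycle.
Variables (n m : nat) (Ts : 'I_n.+1 -> {linear V -> g}).
Variable defect0 : forall d u v w, (d < m)%N -> defect Phi Ts d u v w = 0.

Let F (s : K) (u v w : V) : g :=
  \sum_(d < (4 * n).+1) s ^+ d *: defect Phi Ts (m + d) u v w.

Let F0 u v w : F 0 u v w = defect Phi Ts m u v w.
Proof.
rewrite /F big_ord_recl big1 => [|d _]; last by rewrite expr0n scale0r.
by rewrite expr0 scale1r addr0 addn0.
Qed.

Let FE s u v w : rb_defect (family Ts s) u v w = s ^+ m *: F s u v w.
Proof.
rewrite (@family_defect _ _ s u v w (m + (4 * n).+1)) ?ltn_addl //.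
rewrite big_split_ord /= big1 ?add0r => [|d _]; last by rewrite defect0 ?scaler0.
by rewrite scaler_sumr; apply: eq_bigr => d _; rewrite scalerA -exprD.
Qed.

Let polyfunF x y z : polyfun x -> polyfun y -> polyfun z ->
  polyfun (fun s => F s (x s) (y s) (z s)).
Proof.
move=> px py pz; apply: polyfun_sum => d _; apply: polyfunX.
exact: polyfun_defect.
Qed.

Let P s u v w := brT Phi (family Ts s) u v w.

Let polyfunP u v w : polyfun (fun s => P s u v w).
Proof.
have pc (M : lmodType K) (x : M) := polyfun_const x.
have pf x : polyfun (fun s => family Ts s x) by exact: polyfun_family.
by do ?apply: polyfunD; apply: polyfun_tri.
Qed.

Let polyfunB (M : lmodType K) (h h' : K -> M) :
  polyfun h -> polyfun h' -> polyfun (fun s => h s - h' s).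
Proof. by move=> ph ph'; apply: polyfunD => //; apply: polyfunN. Qed.

Let polyfun_rhoTl u v x : polyfun x ->
  polyfun (fun s => rhoTl Phi (family Ts s) u v (x s)).
Proof.
have pc (M : lmodType K) (y : M) := polyfun_const y.
have pf y : polyfun (fun s => family Ts s y) by exact: polyfun_family.
move=> px; apply: polyfunB; first exact: polyfun_tri.
by apply: polyfun_family; apply: polyfunD; first apply: polyfunD; apply: polyfun_tri.
Qed.

Let polyfun_rhoTm u v x : polyfun x ->
  polyfun (fun s => rhoTm Phi (family Ts s) u (x s) v).
Proof.
have pc (M : lmodType K) (y : M) := polyfun_const y.
have pf y : polyfun (fun s => family Ts s y) by exact: polyfun_family.
move=> px; apply: polyfunB; first exact: polyfun_tri.
by apply: polyfun_family; apply: polyfunD; first apply: polyfunD; apply: polyfun_tri.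
Qed.

Let polyfun_rhoTr u v x : polyfun x ->
  polyfun (fun s => rhoTr Phi (family Ts s) (x s) u v).
Proof.
have pc (M : lmodType K) (y : M) := polyfun_const y.
have pf y : polyfun (fun s => family Ts s y) by exact: polyfun_family.
move=> px; apply: polyfunB; first exact: polyfun_tri.
by apply: polyfun_family; apply: polyfunD; first apply: polyfunD; apply: polyfun_tri.
Qed.

Lemma defect_bianchi a b x y z : 
  let T := Ts ord0 in let D := defect Phi Ts m in
  D a b (brT Phi T x y z) + rhoTl Phi T a b (D x y z)
  - (D (brT Phi T a b x) y z + D x (brT Phi T a b y) z + D x y (brT Phi T a b z)
     + rhoTl Phi T x y (D a b z) + rhoTm Phi T x (D a b y) z
     + rhoTr Phi T (D a b x) y z) = 0.
Proof.
move=> T D.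
pose G s := F s a b (P s x y z) + rhoTl Phi (family Ts s) a b (F s x y z)
  - (F s (P s a b x) y z + F s x (P s a b y) z + F s x y (P s a b z)
     + rhoTl Phi (family Ts s) x y (F s a b z) + rhoTm Phi (family Ts s) x (F s a b y) z
     + rhoTr Phi (family Ts s) (F s a b x) y z).
have T0 : family Ts 0 = T by apply/funext/family0.
have -> : D a b (brT Phi T x y z) + rhoTl Phi T a b (D x y z)
  - (D (brT Phi T a b x) y z + D x (brT Phi T a b y) z + D x y (brT Phi T a b z)
     + rhoTl Phi T x y (D a b z) + rhoTm Phi T x (D a b y) z
     + rhoTr Phi T (D a b x) y z) = G 0.
  by rewrite /G /P T0 !F0.
apply: polyfun_eq0 => [|s s0].
  have pc (M : lmodType K) (u : M) := polyfun_const u.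
  apply: polyfunB.
    by apply: polyfunD; [apply: polyfunF|apply: polyfun_rhoTl; apply: polyfunF].
  apply: polyfunD; last by apply: polyfun_rhoTr; apply: polyfunF.
  apply: polyfunD; last by apply: polyfun_rhoTm; apply: polyfunF.
  apply: polyfunD; last by apply: polyfun_rhoTl; apply: polyfunF.
  by apply: polyfunD; last apply: polyfunF; first by apply: polyfunD; apply: polyfunF.
have sm : s ^+ m != 0 by rewrite expf_neq0.
have := rb_defect_bianchi (family Ts s) a b x y z.
rewrite !FE.
rewrite (linear_funZ _ _ (rhoTl_linear Phi (family Ts s) a b)).
rewrite (linear_funZ _ _ (rhoTl_linear Phi (family Ts s) x y)).
rewrite (linear_funZ _ _ (rhoTm_linear Phi (family Ts s) x z)).
rewrite (linear_funZ _ _ (rhoTr_linear Phi (family Ts s) y z)).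
rewrite -!scalerDr => /(scalerI sm) E.
by rewrite /G /P E subrr.
Qed.


Lemma defect_cocycle (T : V -> g) : T =1 Ts ord0 ->
  is_cocycle Phi T (fun (U : 'I_1 -> V * V) w => defect Phi Ts m (U ord0).1 (U ord0).2 w).
Proof.
move=> /funext->; split; last first.
  apply/funext => U; apply/funext => w; rewrite coboundary2E; exact: defect_bianchi.
split=> [U k v w|U k u w|U]; last exact: defect_linear3.
  by rewrite /setpair [k]ord1; apply: defect_linear1.
by rewrite /setpair [k]ord1; apply: defect_linear2.
Qed.

End Cocycle.
End ObstructionCocycle.

Section ObstructionClass.
Variables (K : closedFieldType) (g : leibniz3 K) (V : representation g).
Variables (Phi : cocycle2 V) (T : twistedRB Phi).

Lemma lin_ext_tconst (A B : lmodType K) n (L : 'I_n.+1 -> {linear A -> B}) x i :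
  lin_ext L (tconst n x) i = L i x.
Proof.
rewrite ffunE (bigD1 i) //= (big_pred1 ord0) => [|j]; last first.
  by rewrite -[X in _ == X]addn0 eqn_add2l.
rewrite ffunE eqxx big1 ?addr0 // => k ki; rewrite big1 // => j /eqP e.
rewrite ffunE; case: eqP => [j0|_]; last by rewrite linear0.
by case/eqP: ki; apply/val_inj; rewrite /= -e j0 /= addn0.
Qed.

Lemma sum_ord_delta (M : zmodType) n (e p : nat) (F : 'I_n.+1 -> M) :
  (forall k, k != ord0 -> F k = 0) ->
  \sum_(k < n.+1 | (e + k == p)%N) F k = if e == p then F ord0 else 0.
Proof.
move=> F0; rewrite big_mkcond big_ord_recl /= addn0 big1 ?addr0 // => i _.
by case: ifP => // _; apply: F0.
Qed.

Lemma sum_ord_conv (M : zmodType) n (i e m : nat) (x : M) : (m <= n)%N ->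
  \sum_(p < n.+1 | (i + p == m)%N) (if e == p then x else 0)
  = if (i + e == m)%N then x else 0.
Proof.
move=> mn; case: ifP => [/eqP E|E].
  have en : (e < n.+1)%N by rewrite ltnS (leq_trans _ mn) // -E leq_addl.
  rewrite (bigD1 (Ordinal en)) /= ?E ?eqxx // big1 ?addr0 // => p.
  by case/andP=> _; rewrite -val_eqE /= eq_sym => /negPf->.
by rewrite big1 // => p /eqP ip; case: eqP => // ep; rewrite ep ip eqxx in E.
Qed.

Lemma defect_coef n (Ts : 'I_n.+1 -> {linear V -> g}) (u v w : V) (m : 'I_n.+1) :
  let Tt (x : V) := lin_ext Ts (tconst n x) in
  (tri_ext (br g) (Tt u) (Tt v) (Tt w)
   - lin_ext Ts (tri_ext (rhol V) (Tt u) (Tt v) (tconst n w)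
                  + tri_ext (rhom V) (Tt u) (tconst n v) (Tt w)
                  + tri_ext (rhor V) (tconst n u) (Tt v) (Tt w)
                  + tri_ext Phi (Tt u) (Tt v) (Tt w))) m
  = defect Phi Ts m u v w.
Proof.
move=> Tt; have TtE x i : Tt x i = Ts i x by exact: lin_ext_tconst.
rewrite !ffunE.
pose Y (j k : 'I_n.+1) := rhol V (Ts j u) (Ts k v) w + rhom V (Ts j u) v (Ts k w)
  + rhor V u (Ts j v) (Ts k w).
have c0 (M : lmodType K) (x : M) : tconst n x ord0 = x by rewrite ffunE eqxx.
have cN (M : lmodType K) (x : M) i : i != ord0 -> tconst n x i = 0.
  by move=> i0; rewrite ffunE (negPf i0).
have X (p : 'I_n.+1) : (tri_ext (rhol V) (Tt u) (Tt v) (tconst n w)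
    + tri_ext (rhom V) (Tt u) (tconst n v) (Tt w)
    + tri_ext (rhor V) (tconst n u) (Tt v) (Tt w) + tri_ext Phi (Tt u) (Tt v) (Tt w)) p
  = \sum_(j < n.+1) \sum_(k < n.+1 | (j + k == p)%N) Y j k
    + \sum_(j < n.+1) \sum_(k < n.+1) \sum_(l < n.+1 | (j + k + l == p)%N)
        Phi (Ts j u) (Ts k v) (Ts l w).
  rewrite !ffunE; congr (_ + _); last first.
    by do 3!(apply: eq_bigr => ? _); rewrite !TtE.
  have -> : \sum_(j < n.+1) \sum_(k < n.+1 | (j + k == p)%N) Y j k =
    \sum_(j < n.+1) \sum_(k < n.+1 | (j + k == p)%N) rhol V (Ts j u) (Ts k v) w
    + \sum_(j < n.+1) \sum_(k < n.+1 | (j + k == p)%N) rhom V (Ts j u) v (Ts k w)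
    + \sum_(j < n.+1) \sum_(k < n.+1 | (j + k == p)%N) rhor V u (Ts j v) (Ts k w).
    by rewrite -!big_split; apply: eq_bigr => j _ /=; rewrite -!big_split.
  congr (_ + _ + _).
  - apply: eq_bigr => j _; rewrite [RHS]big_mkcond /=; apply: eq_bigr => k _.
    rewrite sum_ord_delta ?c0 ?TtE // => l l0; by rewrite cN // tri30.
  - apply: eq_bigr => j _; rewrite (bigD1 ord0) //= addn0 [X in _ + X]big1 ?addr0.
      by apply: eq_bigr => k _; rewrite c0 !TtE.
    by move=> k k0; rewrite big1 // => l _; rewrite cN // tri20.
  - rewrite (bigD1 ord0) //= [X in _ + X]big1 ?addr0.
      by do 2!(apply: eq_bigr => ? _); rewrite c0 !TtE.
    by move=> j j0; do 2!(rewrite big1 // => ? _); rewrite cN // tri10.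
under [X in _ - X]eq_bigr do under eq_bigr do rewrite X linearD.
rewrite /defect -/Y.
have conv (i : 'I_n.+1) (J : finType) (e : J -> nat) (Z : J -> V) :
  \sum_(p < n.+1 | (i + p == m)%N) Ts i (\sum_(k | e k == p) Z k)
  = \sum_(k | (i + e k == m)%N) Ts i (Z k).
  under eq_bigr do rewrite linear_sum big_mkcond.
  rewrite exchange_big /= [RHS]big_mkcond; apply: eq_bigr => k _.
  by rewrite sum_ord_conv // -ltnS.
under [X in _ = X - _]eq_bigr do under eq_bigr do rewrite sumrB.
under [X in _ = X - _]eq_bigr do rewrite sumrB.
rewrite sumrB -addrA -opprD; congr (_ - _).
  by do 3!(apply: eq_bigr => ? _); rewrite !TtE.
rewrite -big_split; apply: eq_bigr => i _ /=; rewrite big_split /=; congr (_ + _).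
  under eq_bigr do rewrite linear_sum; rewrite exchange_big; apply: eq_bigr => j _.
  by rewrite conv; apply: eq_bigl => k; rewrite addnA.
under eq_bigr do rewrite linear_sum; rewrite exchange_big; apply: eq_bigr => j _.
under eq_bigr do rewrite linear_sum; rewrite exchange_big; apply: eq_bigr => k _.
by rewrite conv; apply: eq_bigl => l; rewrite !addnA.
Qed.


Lemma deformation_defect n (Ts : 'I_n.+1 -> {linear V -> g}) :
  is_deformation T Ts <->
  Ts ord0 =1 T /\ forall d u v w, (d <= n)%N -> defect Phi Ts d u v w = 0.
Proof.
split=> [[T0 E]|[T0 E]].
  split=> // d u v w dn; have := defect_coef Ts u v w (Ordinal (dn : (d < n.+1)%N)).
  by move=> /= <-; rewrite E subrr ffunE.
split=> // u v w; apply/eqP; rewrite -subr_eq0; apply/eqP/ffunP => m.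
by rewrite defect_coef ffunE E // -ltnS.
Qed.

Lemma obstruction_cocycle n (Ts : 'I_n.+1 -> {linear V -> g}) :
  is_deformation T Ts -> is_cocycle Phi T (obstruction Phi Ts).
Proof.
case/deformation_defect => T0 d0.
by apply: defect_cocycle => [d u v w|u]; [exact: d0|rewrite T0].
Qed.

Definition obstruction_class n (Ts : 'I_n.+1 -> {linear V -> g})
    (def : is_deformation T Ts) : HH2 T :=
  HH2_class (obstruction_cocycle def).

End ObstructionClass.

(* Main.v *)
(** Adding [S t^(n+1)] to [T_t] leaves the coefficients of the Rota-Baxter
    defect in degrees at most [n] unchanged. In degree [n+1] the new terms are
    those with one index equal to [n+1] and all others [0]; they are linear in
    [S] and add up to [d_T S]. So the extension is a deformation iff
    [Ob_T + d_T S = 0], and it exists iff [Ob_T = d_T (- S)] for some [S]. *)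

Require Import Defs.
From HB Require Import structures.
From mathcomp Require Import all_boot all_order all_algebra.
From mathcomp Require Import boolp functions zify.

Set Implicit Arguments.
Unset Strict Implicit.
Unset Printing Implicit Defensive.

Import GRing.Theory.
Local Open Scope ring_scope.

Section ConvolutionSums.
Variables (M : zmodType) (n d : nat).
Hypothesis dn : (d <= n.+1)%N.

Let wd : 'I_n.+1 -> 'I_n.+2 := widen_ord (leqnSn n.+1).

Let wd0 : wd ord0 = ord0. Proof. exact: val_inj. Qed.

(** The offset [e] stands for the sum of outer indices already fixed, which lets the lemma be
    nested. Since [d <= n.+1], the index [n.+1] leaves no room for a positive offset. *)
Lemma sum1_recr e (F : 'I_n.+2 -> M) :
  \sum_(k < n.+2 | (e + k == d)%N) F k
  = \sum_(k < n.+1 | (e + k == d)%N) F (wd k)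
    + (if (e == 0%N) && (d == n.+1) then F ord_max else 0).
Proof.
rewrite big_mkcond big_ord_recr -big_mkcond /=; congr (_ + _).
by have -> : (e + n.+1 == d)%N = (e == 0%N) && (d == n.+1) by lia.
Qed.

(** The bound on [d] leaves room for the index [0] only. This serves when an outer index is already
    [n.+1]. *)
Lemma sum_max (F : 'I_n.+2 -> M) e : (n.+1 <= e)%N ->
  \sum_(k < n.+2 | (e + k == d)%N) F k
  = if (e == n.+1) && (d == n.+1) then F ord0 else 0.
Proof.
move=> ne; rewrite big_mkcond big_ord_recl big1 /= => [|i _].
  have -> : (e + 0 == d)%N = (e == n.+1) && (d == n.+1) by lia.
  by rewrite addr0.
by rewrite ifF //= /bump /=; lia.
Qed.

(** Split on the outer index: the value [n.+1] falls under [sum_max], and smaller values join the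
    offset of [sum1_recr]. Three and four indices follow the same scheme. *)
Lemma sum2_recr e (F : 'I_n.+2 -> 'I_n.+2 -> M) :
  \sum_(j < n.+2) \sum_(k < n.+2 | (e + j + k == d)%N) F j k
  = \sum_(j < n.+1) \sum_(k < n.+1 | (e + j + k == d)%N) F (wd j) (wd k)
    + (if (e == 0%N) && (d == n.+1) then F ord_max ord0 + F ord0 ord_max else 0).
Proof.
rewrite big_ord_recr /= sum_max ?leq_addl //.
under eq_bigr do rewrite sum1_recr.
(* The inner correction requires [e + j = 0], so among all [j <= n] only [j = 0] can keep one. *)
rewrite big_split /= [X in _ + X + _]big_ord_recl [X in _ + (_ + X) + _]big1.
  rewrite -[widen_ord _ ord0]/(wd ord0) wd0 /= addn0 -addrA; congr (_ + _).
  have -> : (e + n.+1 == n.+1)%N = (e == 0%N) by lia.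
  by case: ifP; rewrite !addr0 // addrC.
by move=> i _ /=; rewrite /bump /= addnA addn1 addSn.
Qed.

Lemma sum3_recr e (F : 'I_n.+2 -> 'I_n.+2 -> 'I_n.+2 -> M) :
  \sum_(i < n.+2) \sum_(j < n.+2) \sum_(k < n.+2 | (e + i + j + k == d)%N) F i j k
  = \sum_(i < n.+1) \sum_(j < n.+1) \sum_(k < n.+1 | (e + i + j + k == d)%N)
      F (wd i) (wd j) (wd k)
    + (if (e == 0%N) && (d == n.+1) then
         F ord_max ord0 ord0 + F ord0 ord_max ord0 + F ord0 ord0 ord_max else 0).
Proof.
rewrite big_ord_recr /=.
have -> : \sum_(j < n.+2) \sum_(k < n.+2 | (e + n.+1 + j + k == d)%N) F ord_max j k
  = if (e == 0%N) && (d == n.+1) then F ord_max ord0 ord0 else 0.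
  rewrite big_ord_recl /= addn0 sum_max ?leq_addl // big1 ?addr0 => [|j _].
    by have -> : (e + n.+1 == n.+1)%N = (e == 0%N) by lia.
  by rewrite big_pred0 // => k; rewrite /= /bump /=; lia.
under eq_bigr do rewrite sum2_recr.
rewrite big_split /= [X in _ + X + _]big_ord_recl [X in _ + (_ + X) + _]big1.
  rewrite -[widen_ord _ ord0]/(wd ord0) wd0 /= addn0 -addrA; congr (_ + _).
  by case: ifP; rewrite !addr0 // addrC addrA.
by move=> i _ /=; rewrite /bump /= addnA addn1 addSn.
Qed.

Lemma sum4_recr (F : 'I_n.+2 -> 'I_n.+2 -> 'I_n.+2 -> 'I_n.+2 -> M) :
  \sum_(i < n.+2) \sum_(j < n.+2) \sum_(k < n.+2)
    \sum_(l < n.+2 | (i + j + k + l == d)%N) F i j k l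
  = \sum_(i < n.+1) \sum_(j < n.+1) \sum_(k < n.+1)
      \sum_(l < n.+1 | (i + j + k + l == d)%N) F (wd i) (wd j) (wd k) (wd l)
    + (if d == n.+1 then
         F ord_max ord0 ord0 ord0 + F ord0 ord_max ord0 ord0
         + F ord0 ord0 ord_max ord0 + F ord0 ord0 ord0 ord_max else 0).
Proof.
rewrite big_ord_recr /=.
have -> : \sum_(j < n.+2) \sum_(k < n.+2)
    \sum_(l < n.+2 | (n.+1 + j + k + l == d)%N) F ord_max j k l
  = if d == n.+1 then F ord_max ord0 ord0 ord0 else 0.
  (* At the positive offset [n.+1] the correction in [sum3_recr] vanishes, and each of the three
     remaining indices can only be [0]. *)
  rewrite sum3_recr /= addr0 big_ord_recl [X in _ + X]big1 => [|j _]; last first.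
    by rewrite big1 // => ? _; rewrite big_pred0 // => l; rewrite /= /bump /=; lia.
  rewrite big_ord_recl [X in _ + X + 0]big1 => [|j _]; last first.
    by rewrite big_pred0 // => l; rewrite /= /bump /=; lia.
  rewrite big_mkcond big_ord_recl big1 => [|l _]; last first.
    by rewrite ifF //= /bump /=; lia.
  rewrite !wd0 /= !addn0 !addr0.
  by rewrite eq_sym.
under eq_bigr do rewrite sum3_recr.
rewrite big_split /= [X in _ + X + _]big_ord_recl [X in _ + (_ + X) + _]big1 //.
rewrite -[widen_ord _ ord0]/(wd ord0) wd0 /= -addrA; congr (_ + _).
by case: ifP; rewrite !addr0 // addrC !addrA.
Qed.

End ConvolutionSums.

Section Extension.
Variables (K : closedFieldType) (g : leibniz3 K) (V : representation g).
Variable Phi : cocycle2 V.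

Lemma extend_max n (Ts : 'I_n.+1 -> {linear V -> g}) S :
  extend Ts S ord_max = S.
Proof. by rewrite /extend unlift_none. Qed.

Lemma extend_widen n (Ts : 'I_n.+1 -> {linear V -> g}) S i :
  extend Ts S (widen_ord (leqnSn n.+1) i) = Ts i.
Proof.
rewrite /extend; have -> : widen_ord (leqnSn n.+1) i = lift ord_max i.
  by apply/val_inj; rewrite /= /bump leqNgt ltn_ord.
by rewrite liftK.
Qed.

Lemma extend0 n (Ts : 'I_n.+1 -> {linear V -> g}) S :
  extend Ts S ord0 = Ts ord0.
Proof. by rewrite -[RHS](extend_widen Ts S); congr extend; apply/val_inj. Qed.

(** With one pair there are no indices [j < k], so the double sum is empty and each other sum has a
    single term. *)
Lemma coboundary1E (T : V -> g) (h : V -> g) (U : 'I_1 -> V * V) w :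
  let u := (U ord0).1 in let v := (U ord0).2 in
  coboundary Phi T (fun _ : 'I_0 -> V * V => h) U w
  = - h (brT Phi T u v w) + rhoTl Phi T u v (h w)
    + (rhoTm Phi T u (h v) w + rhoTr Phi T (h u) v w).
Proof.
move=> u v; rewrite /coboundary !big_ord1 big_pred0 => [|[[]]] //.
have -> : ord_max = ord0 :> 'I_1 by apply/val_inj.
by rewrite add0r expr1 expr0 scaleN1r !scale1r.
Qed.

(** The new terms are grouped by the place of [S]: outermost it gives [- S (brT ...)]; applied to
    [w], [v] or [u] it gives the [rhoTl], [rhoTm] or [rhoTr] term. *)
Lemma defect_extend n (Ts : 'I_n.+1 -> {linear V -> g}) S d u v w :
  (d <= n.+1)%N ->
  defect Phi (extend Ts S) d u v w
  = defect Phi Ts d u v w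
    + (if d == n.+1 then
         - S (brT Phi (Ts ord0) u v w) + rhoTl Phi (Ts ord0) u v (S w)
         + (rhoTm Phi (Ts ord0) u (S v) w + rhoTr Phi (Ts ord0) (S u) v w)
       else 0).
Proof.
move=> dn; rewrite /defect.
rewrite (sum3_recr dn 0) (sum4_recr dn).
rewrite !extend0 !extend_max.
under eq_bigr do under eq_bigr do under eq_bigr do rewrite !extend_widen.
under [X in _ - (X + _)]eq_bigr do under eq_bigr do
  under eq_bigr do under eq_bigr do rewrite !extend_widen.
rewrite opprD addrACA; congr (_ + _).
rewrite eqxx /=; case: ifP => _; last by rewrite subr0.
rewrite /rhoTl /rhoTm /rhoTr /brT !linearD.
by zmod_cancel.
Qed.

Variable T : twistedRB Phi.

Lemma extend_deformation n (Ts : 'I_n.+1 -> {linear V -> g}) S :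
  is_deformation T Ts ->
  is_deformation T (extend Ts S) <->
  obstruction Phi Ts + coboundary Phi T (fun _ : 'I_0 -> V * V => S : V -> g) = 0.
Proof.
move=> /deformation_defect[T0 d0]; have TE : (Ts ord0 : V -> g) = T by apply/funext.
have E u v w : defect Phi (extend Ts S) n.+1 u v w
  = (obstruction Phi Ts + coboundary Phi T (fun _ : 'I_0 -> V * V => S : V -> g))
      (fun=> (u, v)) w.
  rewrite defect_extend // eqxx TE; apply/esym/(congr1 (+%R _)).
  exact: (coboundary1E T S (fun=> (u, v)) w).
split=> [/deformation_defect[_ e0]|e0].
  apply/funext => U; apply/funext => w.
  (* A family indexed by ['I_1] is constant, so [E] covers every [U]. *)
  have -> : U = fun=> ((U ord0).1, (U ord0).2).
    by apply/funext => i; rewrite ord1; case: (U ord0).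
  by rewrite -E e0.
apply/deformation_defect; split=> [x|d u v w]; first by rewrite extend0 T0.
rewrite leq_eqVlt => /predU1P[->|dn]; first by rewrite E e0.
by rewrite defect_extend ?(ltnW dn) // ltn_eqF // addr0 d0.
Qed.

End Extension.

Theorem theorem6p11 (K : closedFieldType) (charK : [pchar K] =i pred0)
    (g : leibniz3 K) (V : representation g) (Phi : cocycle2 V)
    (T : twistedRB Phi) (n : nat) (Ts : 'I_n.+1 -> {linear V -> g})
    (defTs : is_deformation T Ts) :
  extendable T Ts <-> obstruction_class defTs = 0.
Proof.
rewrite /obstruction_class HH2_class_eq0; split=> [[S]|[h [_ _ lh] ObE]].
  move=> /(extend_deformation S defTs)/eqP; rewrite addr_eq0 => /eqP ObE.
  exists (- (fun=> S : V -> g)); last first.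
    by rewrite -sub0r coboundaryB coboundary0 sub0r.
  (* Linearity in the pairs is vacuous over ['I_0]; only the last vector remains. *)
  split=> [U []|U []|U a x y] //.
  by rewrite -[LHS]/(- S _) linearP opprD -scalerN.
(* There is only one family of pairs over ['I_0], so evaluating [h] at this one loses nothing. *)
pose S x := - h (fun i : 'I_0 => (0, 0)) x.
have lS : linear S by move=> a x y; rewrite /S lh opprD scalerN.
pose L : {linear V -> g} := HB.pack S (GRing.isLinear.Build K V g _ S lS).
exists L; apply/(extend_deformation L defTs); rewrite ObE.
have -> : (fun _ : 'I_0 -> V * V => L : V -> g) = - h.
  apply/funext => U; apply/funext => x; congr (- h _ x).
  by apply/funext => -[].
by rewrite -[- h]sub0r coboundaryB coboundary0 sub0r subrr.
Qed.
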